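(* Let $(X,Q,\pi)$ be a finite Markov chain. Then for any mean $\theta$, $$\lambda_1(X) \ge K_\infty(X),$$ where $\lambda_1(X)$ is the smallest positive eigenvalue of $-\Delta$ and $K_\infty(X)=K_{\infty,\theta}(X)$ is the $\infty$-dimensional curvature of $X$ with respect to $\theta$.
   Context: A finite Markov chain $(X,Q,\pi)$ is always assumed irreducible and reversible: $X$ is a finite set, $Q:X\times X\to[0,1]$ satisfies $\sum_{y}Q(x,y)=1$ for all $x$ and is irreducible, $\pi\in(0,1]^X$ is the unique stationary probability measure, and $Q(x,y)\pi(x)=Q(y,x)\pi(y)$ for all $x,y$. For $f,g\in\mathbb{R}^X$ put $\langle f,g\rangle_\pi=\sum_{x}f(x)g(x)\pi(x)$ and $\Delta f(x)=\sum_{y}(f(y)-f(x))Q(x,y)$. A mean is a function $\theta:[0,\infty)\times[0,\infty)\to[0,\infty)$ which is continuous, smooth on $(0,\infty)\times(0,\infty)$, symmetric, monotone ($\theta(r,s)\ge\theta(t,s)$ for $r\ge t$), homogeneous ($\theta(\lambda r,\lambda s)=\lambda\theta(r,s)$) and normalized ($\theta(1,1)=1$). Set $I_\theta=(0,\infty)$ if $\theta(0,s)=0$ for all $s>0$, and $I_\theta=[0,\infty)$ if $\theta(0,s)>0$ for all $s>0$. Write $\partial_1\theta(r,s)=\frac{\partial}{\partial r}\theta(r,s)$ (at boundary points $r=0$ or $s=0$, relevant only if $I_\theta=[0,\infty)$, this is the one-sided partial derivative, implicitly assumed to exist where it is used). For $\rho\in(I_\theta)^X$ define $\Delta_\rho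 f(x)=\sum_{y}2\,\partial_1\theta(\rho(x),\rho(y))(f(y)-f(x))Q(x,y)$, $2\Gamma_\rho(f,g)=\Delta_\rho(fg)-f\Delta_\rho g-g\Delta_\rho f$, $2\Gamma_{2,\rho}(f,g)=\Delta\Gamma_\rho(f,g)-\Gamma_\rho(f,\Delta g)-\Gamma_\rho(g,\Delta f)$, and $\Gamma_\rho f=\Gamma_\rho(f,f)$, $\Gamma_{2,\rho}f=\Gamma_{2,\rho}(f,f)$. $K_{\infty}(X)=K_{\infty,\theta}(X)\in[-\infty,\infty]$ is the supremum of all $K\in\mathbb{R}$ such that $\langle\rho,\Gamma_{2,\rho}f-K\Gamma_\rho f\rangle_\pi\ge0$ for all $\rho\in(I_\theta)^X$ and all $f\in\mathbb{R}^X$. *)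

(* Defs.v *)
From HB Require Import structures.
From mathcomp Require Import all_boot all_order all_algebra.
From mathcomp Require Import all_classical all_reals all_analysis.
Import Order.TTheory GRing.Theory Num.Theory.
Import numFieldNormedType.Exports.

Set Implicit Arguments.
Unset Strict Implicit.
Unset Printing Implicit Defensive.

Local Open Scope classical_set_scope.
Local Open Scope ring_scope.

Section MarkovChain.
Variables (R : realType) (X : finType).
Implicit Types (Q : X -> X -> R) (pi mu f g : X -> R).

Definition prob_measure mu : Prop :=
  (forall x, 0 <= mu x) /\ \sum_x mu x = 1.

Definition stationary Q mu : Prop :=
  forall y, \sum_x mu x * Q x y = mu y.

Record markov_chain Q pi : Prop := MarkovChain {
  mc_kernel01 : forall x y, 0 <= Q x y <= 1;
  mc_kernel_sum1 : forall x, \sum_y Q x y = 1;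
  mc_irreducible : forall x y, connect (fun u v => 0 < Q u v) x y;
  mc_pi01 : forall x, 0 < pi x <= 1;
  mc_pi_prob : prob_measure pi;
  mc_pi_stationary : stationary Q pi;
  mc_pi_unique : forall mu, prob_measure mu -> stationary Q mu -> mu = pi;
  mc_reversible : forall x y, Q x y * pi x = Q y x * pi y
}.

Definition inner pi f g : R := \sum_x f x * g x * pi x.

Definition laplacian Q f : X -> R := fun x => \sum_y (f y - f x) * Q x y.

Definition eigenvalue_opp_laplacian Q (l : R) : Prop :=
  exists2 f : X -> R, f <> (fun=> 0) & forall x, - laplacian Q f x = l * f x.

Definition pos_eigenvalues Q : set R :=
  [set l | 0 < l /\ eigenvalue_opp_laplacian Q l].

(* There are finitely many eigenvalues, so this infimum is a minimum whenever
   a positive eigenvalue exists (see [lambda1_min]); it is +oo on a one-point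
   chain, where -Delta = 0 has no positive eigenvalue. *)
Definition lambda1 Q : \bar R := ereal_inf (EFin @` pos_eigenvalues Q).

Lemma finite_pos_eigenvalues Q : finite_set (pos_eigenvalues Q).
Proof.
pose T x y : R := (x == y)%:R * \sum_z Q x z - Q x y.
have TE f x : \sum_y T x y * f y = - laplacian Q f x.
  rewrite /T /laplacian -sumrN.
  under eq_bigr do rewrite mulrBl -mulrA.
  rewrite sumrB (bigD1 x) //= eqxx mul1r [X in _ + X - _]big1 ?addr0; last first.
    by move=> y /negPf yx; rewrite eq_sym yx mul0r.
  rewrite mulr_suml -sumrB; apply: eq_bigr => y _.
  by rewrite -[RHS]mulNr opprB mulrBl [f x * _]mulrC [f y * _]mulrC.
pose M : 'M[R]_#|X| := \matrix_(i, j) T (enum_val j) (enum_val i).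
have sub : pos_eigenvalues Q `<=` [set l | root (char_poly M) l].
  move=> l [_ [f f0 fl]] /=; rewrite -eigenvalue_root_char.
  apply/eigenvalueP; exists (\row_i f (enum_val i)).
    apply/rowP => j; rewrite !mxE -fl -TE (reindex (enum_val : 'I_#|X| -> X)) /=.
      by apply: eq_bigr => i _; rewrite !mxE mulrC.
    by exists enum_rank => i _; rewrite (enum_valK, enum_rankK).
  apply/eqP => /rowP r0; apply: f0; apply/funext => x.
  by have := r0 (enum_rank x); rewrite !mxE enum_rankK.
apply: contrapT => /(infinite_set_fset (size (char_poly M)))[B BA].
rewrite leqNgt => /negP; apply.
apply: max_poly_roots; first exact/monic_neq0/char_poly_monic.
  by apply/allP => l lB; exact/sub/BA.
exact: finmap.fset_uniq.
Qed.

Lemma lambda1_min Q : pos_eigenvalues Q !=set0 ->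
  exists l, [/\ pos_eigenvalues Q l, lambda1 Q = l%:E &
               forall m, pos_eigenvalues Q m -> l <= m].
Proof.
have /finite_seqP[s sE] := finite_pos_eigenvalues Q.
rewrite /lambda1 sE => -[l0 /= l0s].
have [l ls lmin] : exists2 l, l \in s & forall m, m \in s -> l <= m.
  have := mem_sort <=%O s; have := sort_le_sorted s.
  case: (sort _ s) => [|l t] /= lt E; first by move: l0s; rewrite -E.
  exists l; first by rewrite -E mem_head.
  move=> m; rewrite -E inE => /predU1P[-> //|mt].
  by have /allP/(_ _ mt) := order_path_min le_trans lt.
exists l; split=> //; apply/eqP; rewrite eq_le; apply/andP; split.
  by apply: ereal_inf_lbound; exists l.
by apply: le_ereal_inf_tmp => _ [m /= ms <-]; rewrite lee_fin lmin.
Qed.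

End MarkovChain.

Section Mean.
Variable R : realType.
Implicit Types theta : R -> R -> R.

Definition axis (first : bool) : R * R := if first then (1, 0) else (0, 1).

Definition iter_partial (bs : seq bool) (F : R * R -> R) : R * R -> R :=
  foldr (fun b G => 'D_(axis b) G) F bs.

(* C^infinity on U, for U open. *)
Definition smooth_on (U : set (R * R)) (F : R * R -> R) : Prop :=
  forall bs p, U p ->
    {for p, continuous (iter_partial bs F)} /\
    forall b, derivable (iter_partial bs F) p (axis b).

(* A mean is a function on [0, +oo[ x [0, +oo[; it is represented by a function
   on R x R whose values off the closed quadrant are irrelevant. *)
Record mean theta : Prop := Mean {
  mean_ge0 : forall (r s : R), 0 <= r -> 0 <= s -> 0 <= theta r s;
  mean_continuous :
    {within (`[0, +oo[ `*` `[0, +oo[), continuous (fun p : R * R => theta p.1 p.2)};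
  mean_smooth : smooth_on (`]0, +oo[ `*` `]0, +oo[) (fun p : R * R => theta p.1 p.2);
  mean_symmetric : forall (r s : R), 0 <= r -> 0 <= s -> theta r s = theta s r;
  mean_monotone : forall (r s t : R), 0 <= t -> 0 <= s -> t <= r ->
    theta t s <= theta r s;
  mean_homogeneous : forall (l r s : R), 0 <= l -> 0 <= r -> 0 <= s ->
    theta (l * r) (l * s) = l * theta r s;
  mean_normalized : theta 1 1 = 1
}.

(* By homogeneity theta 0 s = s * theta 0 1, so when the test fails
   theta 0 s > 0 for all s > 0. *)
Definition I_ theta : set R :=
  if `[< forall s : R, 0 < s -> theta 0 s = 0 >]
  then [set r : R | 0 < r] else [set r : R | 0 <= r].

(* Restricting to increments h with 0 <= r + h makes the derivative two-sided
   at r > 0 and a right derivative at r = 0. *)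
Definition partial1_quotient theta (r s : R) :=
  h^-1 * (theta (r + h) s - theta r s) @[h --> within [set h | 0 <= r + h] 0^'].

Definition partial1 theta (r s : R) : R := lim (partial1_quotient theta r s).

Definition partial1_exists theta : Prop :=
  forall r s : R, I_ theta r -> I_ theta s -> cvg (partial1_quotient theta r s).

End Mean.

Section Curvature.
Variables (R : realType) (X : finType).
Implicit Types (Q : X -> X -> R) (pi rho f g : X -> R) (theta : R -> R -> R).

Definition laplacian_rho Q theta rho f : X -> R :=
  fun x => \sum_y 2 * partial1 theta (rho x) (rho y) * (f y - f x) * Q x y.

Definition Gamma_rho Q theta rho f g : X -> R := fun x =>
  (laplacian_rho Q theta rho (f \* g) x - f x * laplacian_rho Q theta rho g x
   - g x * laplacian_rho Q theta rho f x) / 2.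

Definition Gamma2_rho Q theta rho f g : X -> R := fun x =>
  (laplacian Q (Gamma_rho Q theta rho f g) x
   - Gamma_rho Q theta rho f (laplacian Q g) x
   - Gamma_rho Q theta rho g (laplacian Q f) x) / 2.

Definition curvature_bound Q pi theta (K : R) : Prop :=
  forall rho f, (forall x, I_ theta (rho x)) ->
    0 <= inner pi rho (fun x =>
           Gamma2_rho Q theta rho f f x - K * Gamma_rho Q theta rho f f x).

Definition K_infty Q pi theta : \bar R :=
  ereal_sup (EFin @` [set K | curvature_bound Q pi theta K]).

End Curvature.

(* Main.v *)
Require Import Defs.
From mathcomp Require Import all_boot all_order all_algebra.
From mathcomp Require Import all_classical all_reals all_analysis.
From mathcomp Require Import ring lra.
Import Order.TTheory GRing.Theory Num.Theory.
Import numFieldNormedType.Exports.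

Set Implicit Arguments.
Unset Strict Implicit.
Unset Printing Implicit Defensive.

Local Open Scope ereal_scope.

(** At the constant density 1 every mean looks the same: symmetry and
    homogeneity force its first partial derivative at (1, 1) to be 1/2
    ([partial1_11]), so that the density-dependent Laplacian is the ordinary
    one.  For an eigenfunction f with - Delta f = l f, the last two terms of
    Gamma_2 f then add up to l Gamma f, while the first one,
    Delta (Gamma f) / 2, has zero pi-average by stationarity
    ([sum_laplacian]).  Hence testing a curvature bound K on the pair (1, f)
    gives (l - K) <1, Gamma f> >= 0.  Finally
    <1, Gamma f> = - <f, Delta f> = l <f, f>, again because Delta (f^2) has
    zero average; this is positive when l is, and therefore K <= l. *)

Section MeanDiagonal.
Local Open Scope classical_set_scope.
Local Open Scope ring_scope.
Context {R : realType}.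

Lemma within_mem {T : Type} (F : set_system T) (A : set T) :
  Filter F -> F A -> within A F = F.
Proof.
move=> FF FA; apply/seteqP; split => B; last exact: (@cvg_within T F).
by move=> FAB; apply: filterS2 FA FAB => x Ax; apply.
Qed.

(** The map r |-> r^-1 near r = 1, read in the increment h = r - 1. *)
Definition inv_increment (h : R) : R := - h / (1 + h).

Lemma near0_gtN1 : \forall h \near (0 : R)^', 0 < 1 + h.
Proof.
near=> h.
have : `|h| < 1 by near: h; exact: dnbhs0_lt.
by rewrite ltr_norml => /andP[? ?]; lra.
Unshelve. all: by end_near. Qed.

Lemma inv_increment_dnbhs : inv_increment h @[h --> 0^'] --> 0^'.
Proof.
have cvg0 : inv_increment h @[h --> 0^'] --> (0 : R).
  apply: cvg_within_filter.
  suff : inv_increment h @[h --> (0 : R)] --> (- 0 / (1 + 0) : R).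
    by rewrite oppr0 mul0r.
  apply: cvgM; first by apply: cvgN; exact: cvg_id.
  apply: cvgV; first by rewrite addr0 oner_neq0.
  by apply: cvgD; [exact: cvg_cst|exact: cvg_id].
move=> B B0; have := cvg0 _ B0.
rewrite /nbhs /= => B0'.
have h_neq0 : \forall h \near (0 : R)^', h != 0 by exact: nbhs_dnbhs_neq.
apply: filterS3 B0' h_neq0 near0_gtN1 => h /= Bh h0 h1; apply: Bh.
by rewrite /inv_increment mulf_neq0 // ?oppr_eq0 // invr_eq0 gt_eqF.
Qed.

(** With q h the difference quotient of theta (., 1) at 1, homogeneity and
    symmetry give theta (1 + h, 1) = (1 + h) theta (1 / (1 + h), 1), that is,
    q h = 1 - q k for k = 1 / (1 + h) - 1.  In the limit the derivative a
    satisfies a = 1 - a. *)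
Lemma partial1_11 (theta : R -> R -> R) :
  mean theta -> cvg (partial1_quotient theta 1 1) -> partial1 theta 1 1 = 1 / 2.
Proof.
move=> mt; rewrite /partial1 /partial1_quotient within_mem; last first.
  by apply: filterS near0_gtN1 => h /ltW.
set q : R -> R := fun h => h^-1 * (theta (1 + h) 1 - theta 1 1).
set a := lim _ => qa.
have sum_cvg : q h + q (inv_increment h) @[h --> 0^'] --> a + a.
  by apply: cvgD; [exact: qa|exact: cvg_comp inv_increment_dnbhs qa].
have sum1 : \forall h \near (0 : R)^', q h + q (inv_increment h) = 1.
  have h_neq0 : \forall h \near (0 : R)^', h != 0 by exact: nbhs_dnbhs_neq.
  apply: filterS2 h_neq0 near0_gtN1 => h h0 h1.
  have invE : 1 + inv_increment h = (1 + h)^-1.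
    by rewrite /inv_increment; field; rewrite gt_eqF.
  have thE : theta (1 + h) 1 = (1 + h) * theta (1 + inv_increment h) 1.
    rewrite -(mean_homogeneous mt) ?invE ?invr_ge0 ?ler01 ?(ltW h1) //.
    by rewrite divff ?gt_eqF // mulr1 (mean_symmetric mt) ?ler01 ?(ltW h1).
  rewrite /q thE (mean_normalized mt) /inv_increment.
  by field; rewrite h0 gt_eqF.
have : a + a = 1.
  apply: (cvg_unique _ sum_cvg); first exact: Rhausdorff.
  exact: cvg_near_cst sum1.
lra.
Qed.

End MeanDiagonal.

Section ConstantDensity.
Local Open Scope ring_scope.
Context {R : realType} {X : finType}.
Implicit Types (Q : X -> X -> R) (pi f g : X -> R) (theta : R -> R -> R).

Lemma laplacianZ Q (c : R) f : laplacian Q (fun x => c * f x) =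
  fun x => c * laplacian Q f x.
Proof.
by apply/funext => x; rewrite mulr_sumr; apply: eq_bigr => y _; ring.
Qed.

(** This is stationarity in dual form: Delta f = Q f - f, and Q f and f have the
    same pi-average. *)
Lemma sum_laplacian Q pi f : markov_chain Q pi ->
  \sum_x laplacian Q f x * pi x = 0.
Proof.
move=> mc; rewrite /laplacian.
transitivity (\sum_x \sum_y f y * (pi x * Q x y)
              - \sum_x f x * pi x * \sum_y Q x y).
  rewrite -sumrB; apply: eq_bigr => x _.
  by rewrite mulr_suml mulr_sumr -sumrB; apply: eq_bigr => y _; ring.
rewrite exchange_big /=; apply/eqP; rewrite subr_eq0; apply/eqP.
apply: eq_bigr => x _.
by rewrite -mulr_sumr (mc_pi_stationary mc) (mc_kernel_sum1 mc) mulr1.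
Qed.

Lemma I_1 theta : I_ theta 1.
Proof. by rewrite /I_; case: ifP => _ /=; [exact: ltr01|exact: ler01]. Qed.

Lemma laplacian_rho1 Q theta f : partial1 theta 1 1 = 1 / 2 ->
  laplacian_rho Q theta (fun=> 1) f = laplacian Q f.
Proof.
move=> t11; apply/funext => x; apply: eq_bigr => y _.
by rewrite t11 mul1r divff ?pnatr_eq0 // mul1r.
Qed.

Lemma Gamma_rho1 Q theta f g : partial1 theta 1 1 = 1 / 2 ->
  Gamma_rho Q theta (fun=> 1) f g = fun x =>
  (laplacian Q (f \* g) x - f x * laplacian Q g x - g x * laplacian Q f x) / 2.
Proof. by move=> t11; apply/funext => x; rewrite /Gamma_rho !laplacian_rho1. Qed.

(** Summing 2 Gamma f = Delta (f^2) - 2 f Delta f against pi kills the first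
    term. *)
Lemma sum_Gamma_eigen Q pi theta (l : R) f :
  markov_chain Q pi -> partial1 theta 1 1 = 1 / 2 ->
  (forall x, - laplacian Q f x = l * f x) ->
  \sum_x Gamma_rho Q theta (fun=> 1) f f x * pi x = l * inner pi f f.
Proof.
move=> mc t11 fl; rewrite Gamma_rho1 //.
transitivity (2^-1 * \sum_x laplacian Q (f \* f) x * pi x + l * inner pi f f).
  rewrite /inner !mulr_sumr -big_split /=; apply: eq_bigr => x _.
  have -> : laplacian Q f x = - (l * f x) by rewrite -fl opprK.
  by field.
by rewrite sum_laplacian // mulr0 add0r.
Qed.

(** Gamma is linear in its second argument, so each of the two terms
    Gamma (f, Delta f) equals - l Gamma f. *)
Lemma Gamma2_eigen Q theta (l : R) f : partial1 theta 1 1 = 1 / 2 ->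
  (forall x, - laplacian Q f x = l * f x) ->
  Gamma2_rho Q theta (fun=> 1) f f = fun x =>
    2^-1 * laplacian Q (Gamma_rho Q theta (fun=> 1) f f) x
    + l * Gamma_rho Q theta (fun=> 1) f f x.
Proof.
move=> t11 fl; have lapf : laplacian Q f = fun x => - l * f x.
  by apply/funext => x; rewrite mulNr -fl opprK.
have GammaZ :
    Gamma_rho Q theta (fun=> 1) f (laplacian Q f) =
    fun x => - l * Gamma_rho Q theta (fun=> 1) f f x.
  rewrite !Gamma_rho1 // lapf; apply/funext => x.
  have -> : (f \* (fun x0 => - l * f x0)) = (fun x0 => - l * (f \* f) x0).
    by apply/funext => z /=; ring.
  by rewrite !laplacianZ lapf; field.
by apply/funext => x; rewrite /Gamma2_rho GammaZ; field.
Qed.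

Lemma inner_gt0 pi f : (forall x, 0 < pi x) -> f <> (fun=> 0) ->
  0 < inner pi f f.
Proof.
move=> pi0 f0.
have term_ge0 x : 0 <= f x * f x * pi x.
  by rewrite mulr_ge0 // ?(ltW (pi0 x)) // -expr2 sqr_ge0.
rewrite lt_neqAle sumr_ge0 // andbT eq_sym; apply/negP.
rewrite psumr_eq0 // => /allP sum0; apply: f0; apply/funext => x.
have := sum0 x (mem_index_enum x).
by rewrite /= !mulf_eq0 orbb (gt_eqF (pi0 x)) orbF => /eqP.
Qed.

Lemma curvature_bound_le_eigenvalue Q pi theta (K l : R) :
  markov_chain Q pi -> partial1 theta 1 1 = 1 / 2 ->
  curvature_bound Q pi theta K -> pos_eigenvalues Q l -> K <= l.
Proof.
move=> mc t11 cK [l0 [f f0 fl]].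
have := cK (fun=> 1) f (fun=> I_1 theta).
set G := Gamma_rho Q theta (fun=> 1) f f.
have -> : inner pi (fun=> 1) (fun x =>
      Gamma2_rho Q theta (fun=> 1) f f x - K * G x) =
    2^-1 * (\sum_x laplacian Q G x * pi x) + (l - K) * \sum_x G x * pi x.
  rewrite (Gamma2_eigen t11 fl) -/G /inner !mulr_sumr -big_split /=.
  by apply: eq_bigr => x _; ring.
rewrite sum_laplacian // mulr0 add0r (sum_Gamma_eigen mc t11 fl).
have ff0 : 0 < inner pi f f.
  by apply: inner_gt0 => // x; case/andP: (mc_pi01 mc x).
by rewrite pmulr_lge0 ?subr_ge0 // mulr_gt0.
Qed.

End ConstantDensity.

Theorem theorem1p3 (R : realType) (X : finType) (Q : X -> X -> R) (pi : X -> R)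
    (theta : R -> R -> R) :
  markov_chain Q pi -> mean theta -> partial1_exists theta ->
  K_infty Q pi theta <= lambda1 Q.
Proof.
move=> mc mt ex.
have t11 := partial1_11 mt (ex 1%R 1%R (I_1 theta) (I_1 theta)).
apply: ge_ereal_sup => _ [K cK <-]; apply: le_ereal_inf_tmp => _ [l posl <-].
by rewrite lee_fin; exact: (curvature_bound_le_eigenvalue mc t11 cK posl).
Qed.
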